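(* Assume that the learned components are linear in the parameters, i.e. $$\beta_{\theta_1}(x)=\sum_{k=1}^{K_1}\theta_k^1\,\beta_k(x),\qquad \alpha_{\theta_2}(x)=\sum_{k=1}^{K_2}\theta_k^2\,\alpha_k(x),$$ where $\theta_1=(\theta^1_1,\dots,\theta^1_{K_1})$, $\theta_2=(\theta^2_1,\dots,\theta^2_{K_2})$, and $\beta_k$ ($\mathbb{R}^q$-valued) and $\alpha_k$ ($\mathbb{R}^{q\times q}$-valued) are continuous functions of $x$. Then the optimization problem $(\mathbf{P})\colon\min_{\theta\in\Theta}L(\theta)$ is convex (that is, $L$ is a convex function on the convex set $\Theta$). Moreover, if $\{\beta_k\}_{k=1}^{K_1}$ and $\{\alpha_k\}_{k=1}^{K_2}$ are each linearly independent (as families of functions on $D$), then $(\mathbf{P})$ is strongly convex (that is, $L$ is strongly convex on $\Theta$).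
   Context: Plant and model. Let $D\subset\mathbb{R}^n$ be compact. The plant is the square control-affine system $\dot x=f_p(x)+g_p(x)u$, $y=h_p(x)$, with state $x\in\mathbb{R}^n$, input $u\in\mathbb{R}^q$, output $y\in\mathbb{R}^q$, and $f_p\colon\mathbb{R}^n\to\mathbb{R}^n$, $g_p\colon\mathbb{R}^n\to\mathbb{R}^{n\times q}$, $h_p\colon\mathbb{R}^n\to\mathbb{R}^q$ smooth. The nominal model is another such smooth system $\dot x=f_m(x)+g_m(x)u$, $y=h_m(x)$. Each has a well-defined vector relative degree on $D$, and the two relative degrees are equal to a common $(\gamma_1,\dots,\gamma_q)$. That is, for the plant, writing $g_{p,i}$ for the $i$-th column of $g_p$, $h_{p,j}$ for the $j$-th component of $h_p$, and $L_fh=\frac{dh}{dx}f$ for the Lie derivative, $\gamma_j$ is the number of times $y_j$ must be differentiated for at least one input to appear ($L_{g_{p,i}}L_{f_p}^k h_{p,j}\equiv 0$ on $D$ for all $i$ and $0\le k<\gamma_j-1$), so that $$[y_1^{(\gamma_1)},\dots,y_q^{(\gamma_q)}]^T=b_p(x)+A_p(x)u,$$ where $b_p(x)\in\mathbb{R}^q$ has entries $L_{f_p}^{\gamma_j}h_{p,j}(x)$ and $A_p(x)\in\mathbb{R}^{q\times q}$ has $(j,i)$ entry $L_{g_{p,i}}L_{f_p}^{\gamma_j-1}h_{p,j}(x)$, and $A_p(x)$ is invertible (bounded away from singularity) for $x\in D$. The same holds for the model with $b_m,A_m$. The linearizing controller of the model is $u_m(x,v)=\beta_m(x)+\alpha_m(x)v$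 with $\beta_m=-A_m^{-1}b_m$, $\alpha_m=A_m^{-1}$; if no nominal model is available one sets $\beta_m\equiv 0$, $\alpha_m\equiv0$. Learned controller. $\Theta_1\subset\mathbb{R}^{K_1}$ and $\Theta_2\subset\mathbb{R}^{K_2}$ are convex sets, $\Theta=\Theta_1\times\Theta_2$, $\theta=(\theta_1,\theta_2)\in\Theta$. With $\beta_{\theta_1}(x)\in\mathbb{R}^q$ and $\alpha_{\theta_2}(x)\in\mathbb{R}^{q\times q}$ parameterized functions (of the form given in the claim), the learned controller is $$\hat u_\theta(x,v)=[\beta_m(x)+\beta_{\theta_1}(x)]+[\alpha_m(x)+\alpha_{\theta_2}(x)]v .$$ Loss. Let $W_\theta(x,v)=b_p(x)+A_p(x)\hat u_\theta(x,v)$ and $\ell(x,v,\theta)=\|v-W_\theta(x,v)\|_2^2$. Let $X$ be a probability distribution on $\mathbb{R}^n$ with support $D$ and $V$ the uniform distribution on $\{v\in\mathbb{R}^q:\|v\|\le1\}$. Define $L(\theta)=\mathbb{E}_{x\sim X,\,v\sim V}\,\ell(x,v,\theta)$. *)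

(* Defs.v *)
From HB Require Import structures.
From mathcomp Require Import all_boot all_order all_algebra.
From mathcomp Require Import lra.
From mathcomp Require Import all_classical all_reals all_analysis.
From mathcomp Require Import measurable_realfun lebesgue_measure.

Set Implicit Arguments.
Unset Strict Implicit.
Unset Printing Implicit Defensive.

Import Order.TTheory GRing.Theory Num.Theory.
Import numFieldNormedType.Exports.

Local Open Scope classical_set_scope.
Local Open Scope ring_scope.

(** Borel sigma-algebra of ['M[R]_(m, n)], generated by the open sets. *)

Fact mx_borel_display : measure_display. Proof. by constructor. Qed.

Section mx_borel.
Context {R : realType} {m n : nat}.

Definition mx_borel : set (set 'M[R]_(m, n)) := <<s open >>.

Let mx_borel0 : mx_borel set0.
Proof. exact: sigma_algebra0. Qed.

Let mx_borelC (A : set 'M[R]_(m, n)) : mx_borel A -> mx_borel (~` A).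
Proof. exact: sigma_algebraC. Qed.

Let mx_borel_bigcup (F : (set 'M[R]_(m, n))^nat) :
  (forall i, mx_borel (F i)) -> mx_borel (\bigcup_i F i).
Proof. exact: sigma_algebra_bigcup. Qed.

HB.instance Definition _ := @isMeasurable.Build mx_borel_display
  'M[R]_(m, n) mx_borel mx_borel0 mx_borelC mx_borel_bigcup.

End mx_borel.

Lemma mx_open_measurable (R : realType) m n (U : set 'M[R]_(m, n)) :
  open U -> measurable U.
Proof. exact: sub_sigma_algebra. Qed.

Lemma mx_continuous_measurable (R : realType) m n (f : 'M[R]_(m, n) -> R) :
  continuous f -> measurable_fun [set: 'M[R]_(m, n)] f.
Proof.
move=> /continuousP cf.
apply: (measurability _ (RGenOpens.measurableE R)).
move=> _ [_ [a [b ->]] <-]; rewrite setTI.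
by apply: mx_open_measurable; apply: cf; exact: interval_open.
Qed.

Lemma mx_coord_measurable (R : realType) m n (i : 'I_m) (j : 'I_n) :
  measurable_fun [set: 'M[R]_(m, n)] (fun A => A i j).
Proof. by apply: mx_continuous_measurable; exact: coord_continuous. Qed.

Lemma measurable_fun_cV d (T : measurableType d) (R : realType) n
    (f : T -> 'cV[R]_n) :
  (forall i, measurable_fun [set: T] (fun t => f t i 0)) ->
  measurable_fun [set: T] f.
Proof.
move=> mf; apply: (measurability (open : set (set 'cV[R]_n))) => // _ [U oU <-]; rewrite setTI.
pose box (p : 'cV[rat]_n * rat) : set 'cV[R]_n :=
  [set v | forall i, `|ratr (p.1 i 0) - v i 0| < ratr p.2].
have -> : f @^-1` U =
    \bigcup_(p in [set p | box p `<=` U]) (f @^-1` box p).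
  apply/seteqP; split => [t /= Ut|t [p /= pU]]; last exact: pU.
  have /nbhs_ballP[e /= e0 eU] := open_nbhs_nbhs (conj oU Ut).
  have /rat_in_itvoo[r] : 0 < e / 2 by rewrite divr_gt0.
  rewrite in_itv/= => /andP[r0 re].
  have /choice[c cP] : forall i, exists c : rat, `|ratr c - f t i 0| < ratr r.
    move=> i; have /rat_in_itvoo[c] : f t i 0 - ratr r < f t i 0 + ratr r.
      by rewrite ltrD2l gtrN.
    by rewrite in_itv/= -ltr_distl => ?; exists c.
  exists (\col_i c i, r) => /=; last by move=> i; rewrite mxE.
  move=> v /= vP; apply: eU; split => // i j; rewrite ord1 /ball/=.
  have := vP i; rewrite mxE => vi; have ci := cP i.
  rewrite distrC in ci.
  rewrite (le_lt_trans (ler_distD (ratr (c i)) _ _))// (lt_trans (ltrD ci vi))//.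
  lra.
rewrite bigcup_mkcond; apply: countable_bigcupT_measurable => // p.
case: ifPn => // _.
have -> : f @^-1` box p =
    \bigcap_(i in [set: 'I_n]) [set t | `|ratr (p.1 i 0) - f t i 0| < ratr p.2].
  by apply/seteqP; split => [t tp i _|t tp i]; exact: tp.
apply: fin_bigcap_measurable => // i _.
pose g t := `|ratr (p.1 i 0) - f t i 0|.
have mg : measurable_fun [set: T] g.
  by apply: measurableT_comp => //; exact: measurable_funB.
have := mg measurableT _ (measurable_itv `]-oo, ratr p.2[).
by rewrite setTI.
Qed.

(** Lebesgue measure on ['cV[R]_n], as the [n]-fold product of the Lebesgue
    measure on [R]. *)

Section lebesgue_cV.
Context {R : realType}.

Definition cV_cons n (p : measurableTypeR R * 'cV[R]_n) : 'cV[R]_n.+1 :=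
  \col_i oapp (fun j => p.2 j 0) p.1 (unlift ord0 i).

Definition cV_uncons n (v : 'cV[R]_n.+1) : measurableTypeR R * 'cV[R]_n :=
  (v ord0 0, \col_i v (lift ord0 i) 0).

Lemma cV_consK n : cancel (@cV_cons n) (@cV_uncons n).
Proof.
move=> [t v]; congr pair; first by rewrite mxE unlift_none.
by apply/colP => i; rewrite !mxE liftK.
Qed.

Lemma measurable_cV_cons n : measurable_fun setT (@cV_cons n).
Proof.
apply: measurable_fun_cV => i; under eq_fun do rewrite mxE.
case: unliftP => [j _|_] /=; last exact: measurable_fst.
by apply: (measurableT_comp (mx_coord_measurable j 0)).
Qed.

Lemma measurable_cV_uncons n : measurable_fun setT (@cV_uncons n).
Proof.
apply: measurable_fun_pair; first exact: mx_coord_measurable.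
apply: measurable_fun_cV => i; under eq_fun do rewrite mxE.
exact: mx_coord_measurable.
Qed.

Section step.
Context {n : nat} (mu : {sigma_finite_measure set 'cV[R]_n -> \bar R}).

Definition lebesgue_cVS : set 'cV[R]_n.+1 -> \bar R :=
  pushforward (@lebesgue_measure R \x mu)%E (@cV_cons n).

HB.instance Definition _ := Measure.copy lebesgue_cVS
  (measure_function_pushforward__canonical__measure_function_Measure
     (@lebesgue_measure R \x mu)%E (@measurable_cV_cons n)).

Let lebesgue_cVS_sigma_finite : sigma_finite setT lebesgue_cVS.
Proof.
have /sigma_finiteP[F [FT ndF Ffin]] := sigma_finiteT (@lebesgue_measure R).
have /sigma_finiteP[G [GT ndG Gfin]] := sigma_finiteT mu.
exists (fun k => @cV_uncons n @^-1` (F k `*` G k)) => [|k].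
  apply/seteqP; split => // v _.
  have [k _ Fk] : (\bigcup_k F k) (cV_uncons v).1 by rewrite -FT.
  have [l _ Gl] : (\bigcup_k G k) (cV_uncons v).2 by rewrite -GT.
  exists (maxn k l) => //; split.
  - by move: Fk; exact/subsetPset/ndF/leq_maxl.
  - by move: Gl; exact/subsetPset/ndG/leq_maxr.
have [mF Fk] := Ffin k; have [mG Gk] := Gfin k; split.
  rewrite -[X in measurable X]setTI; apply: measurable_cV_uncons => //.
  exact: measurableX.
rewrite /lebesgue_cVS /pushforward -comp_preimage.
rewrite (_ : _ \o _ = id); last by apply/funext => p /=; rewrite cV_consK.
by rewrite preimage_id product_measure1E// lte_mul_pinfty// ge0_fin_numE.
Qed.

HB.instance Definition _ := Measure_isSigmaFinite.Build _ _ _ lebesgue_cVS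
  lebesgue_cVS_sigma_finite.

End step.

Fixpoint lebesgue_cV n : {sigma_finite_measure set 'cV[R]_n -> \bar R} :=
  if n is m.+1 then lebesgue_cVS (lebesgue_cV m) else \d_(0 : 'cV[R]_0).

End lebesgue_cV.

Lemma lebesgue_cV_box (R : realType) n (a b : 'cV[R]_n) :
  (forall i, a i 0 <= b i 0) ->
  lebesgue_cV n [set v | forall i, a i 0 <= v i 0 <= b i 0] =
  (\prod_i (b i 0 - a i 0))%:E.
Proof.
elim: n a b => [|n IH] a b ab.
  by rewrite big_ord0 /= diracE mem_set// => -[].
rewrite /= /lebesgue_cVS /pushforward.
pose a' : 'cV[R]_n := \col_i a (lift ord0 i) 0.
pose b' : 'cV[R]_n := \col_i b (lift ord0 i) 0.
pose B : set 'cV[R]_n := [set v | forall i, a' i 0 <= v i 0 <= b' i 0].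
have mB : measurable B.
  have -> : B = \bigcap_(i in [set: 'I_n])
      ((fun v : 'cV[R]_n => v i 0) @^-1` `[a' i 0, b' i 0]).
    apply/seteqP; split => [v vB i _|v vB i]; first by rewrite /= in_itv; apply: vB.
    by have := vB i Logic.I; rewrite /= in_itv.
  apply: fin_bigcap_measurable => // i _; rewrite -[X in measurable X]setTI.
  by apply: mx_coord_measurable => //; exact: measurable_itv.
rewrite [X in product_measure1 _ _ X](_ : _ = `[a ord0 0, b ord0 0] `*` B).
  rewrite product_measure1E// IH; last by move=> i; rewrite !mxE.
  rewrite /= lebesgue_measure_itv/= lte_fin big_ord_recl.
  have := ab ord0; rewrite le_eqVlt => /orP[/eqP ->|->].
    by rewrite ltxx subrr mul0r mul0e.
  rewrite -EFinB -EFinM; congr (_ * _)%:E.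
  by apply: eq_bigr => i _; rewrite !mxE.
apply/seteqP; split => [[t v] /= tv|[t v] /= [+ vB] i].
  split; first by have := tv ord0; rewrite !mxE unlift_none in_itv.
  by move=> i; have := tv (lift ord0 i); rewrite !mxE liftK.
rewrite in_itv/= mxE => t0; case: unliftP => [j ->|->//] /=.
by have := vB j; rewrite !mxE.
Qed.

(** Euclidean norm; the library's norm on matrices is the sup norm. *)
Definition enorm {R : realType} {n} (v : 'cV[R]_n) : R :=
  Num.sqrt (\sum_i v i 0 ^+ 2).

(** Uniform distribution on the closed Euclidean unit ball. *)

Section uniform_ball.
Context {R : realType} (q : nat).

Definition eunit_ball : set 'cV[R]_q := [set v | enorm v <= 1].

Let enorm_le1 (v : 'cV[R]_q) : (enorm v <= 1) = (\sum_i v i 0 ^+ 2 <= 1).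
Proof. by rewrite /enorm -[X in _ <= X]sqrtr1 ler_sqrt. Qed.

Lemma measurable_eunit_ball : measurable eunit_ball.
Proof.
have mf : measurable_fun [set: 'cV[R]_q] (fun v => \sum_i v i 0 ^+ 2).
  apply: measurable_sum => i; apply: measurable_funX.
  exact: mx_coord_measurable.
have := mf measurableT _ (measurable_itv `]-oo, 1]); rewrite setTI.
congr (measurable _); apply/seteqP; split => v;
  by rewrite /= in_itv/= -enorm_le1.
Qed.

(** [mnormalize] falls back on its second argument when the total mass is [0]
    or [+oo], which does not happen here by [lebesgue_eunit_ball]. *)
Definition uniform_ball : set 'cV[R]_q -> \bar R :=
  mnormalize (mrestr (lebesgue_cV q) measurable_eunit_ball) \d_(0 : 'cV[R]_q).

HB.instance Definition _ := Probability.on uniform_ball.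

Lemma lebesgue_eunit_ball : (0 < lebesgue_cV q eunit_ball < +oo)%E.
Proof.
pose box (r : R) : set 'cV[R]_q :=
  [set v | forall i, (const_mx (- r) : 'cV_q) i 0 <= v i 0
                     <= (const_mx r : 'cV_q) i 0].
have boxE r : 0 <= r -> lebesgue_cV q (box r) = ((r + r) ^+ q)%:E.
  move=> r0; rewrite lebesgue_cV_box; last first.
    by move=> i; rewrite !mxE (le_trans _ r0)// oppr_le0.
  under eq_bigr do rewrite !mxE opprK.
  by rewrite prodr_const card_ord.
have mbox r : measurable (box r).
  have -> : box r = \bigcap_(i in [set: 'I_q])
      ((fun v : 'cV[R]_q => v i 0) @^-1` `[- r, r]).
    apply/seteqP; split => v vr i; last first.
      by have := vr i Logic.I; rewrite /= in_itv/= !mxE.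
    by move=> _; have := vr i; rewrite /= in_itv/= !mxE.
  apply: fin_bigcap_measurable => // i _; rewrite -[X in measurable X]setTI.
  by apply: mx_coord_measurable => //; exact: measurable_itv.
have q0 : 0 < q.+1%:R^-1 :> R by rewrite invr_gt0.
apply/andP; split.
  apply: (@lt_le_trans _ _ (lebesgue_cV q (box q.+1%:R^-1))).
    by rewrite boxE ?ltW// lte_fin exprn_gt0// addr_gt0.
  apply: le_measure; rewrite ?inE//; first exact: measurable_eunit_ball.
  move=> v vb; rewrite /eunit_ball/= enorm_le1.
  apply: (@le_trans _ _ (\sum_(i < q) q.+1%:R^-1)).
    apply: ler_sum => i _; have := vb i; rewrite !mxE -ler_norml => vi.
    rewrite -real_normK ?num_real// expr2 -[leRHS]mulr1 ler_pM//.
    by rewrite (le_trans vi)// invf_le1// ler1n.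
  rewrite sumr_const card_ord -[leLHS]mulr_natl ler_pdivrMr// mul1r ler_nat.
  exact: leqnSn.
apply: (@le_lt_trans _ _ (lebesgue_cV q (box 1))); last by rewrite boxE// ltry.
apply: le_measure; rewrite ?inE//; first exact: measurable_eunit_ball.
move=> v; rewrite /eunit_ball/= enorm_le1 => v1 i; rewrite !mxE -ler_norml.
rewrite -(@ler_pXn2r _ 2)// ?nnegrE// real_normK ?num_real// expr1n.
rewrite (le_trans _ v1)// (bigD1 i)//= lerDl sumr_ge0// => j _.
exact: sqr_ge0.
Qed.

End uniform_ball.
Arguments eunit_ball {R} q _.
Arguments uniform_ball {R} q _.

Section smooth.
Context {R : realType} {n : nat}.

Definition partial {W : normedModType R} (i : 'I_n) (f : 'cV[R]_n -> W)
    (x : 'cV[R]_n) : W :=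
  'D_(delta_mx i 0) f x.

(** [C^oo]; a sequence of indices encodes an iterated partial derivative. *)
Definition smooth {W : normedModType R} (f : 'cV[R]_n -> W) : Prop :=
  forall s : seq 'I_n, let g := foldr partial f s in
    continuous g /\ forall x i, derivable g x (delta_mx i 0).

Definition gradient (h : 'cV[R]_n -> R^o) (x : 'cV[R]_n) : 'rV[R]_n :=
  \row_i partial i h x.

Definition lie (F : 'cV[R]_n -> 'cV[R]_n) (h : 'cV[R]_n -> R^o) :
    'cV[R]_n -> R^o :=
  fun x => (gradient h x *m F x) 0 0.

End smooth.

Record control_system (R : realType) (n q : nat) := ControlSystem {
  drift : 'cV[R]_n -> 'cV[R]_n ;
  input_field : 'cV[R]_n -> 'M[R]_(n, q) ;
  output : 'cV[R]_n -> 'cV[R]_q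
}.

Section relative_degree.
Context {R : realType} {n q : nat}.
Variable S : control_system R n q.

Definition smooth_system : Prop :=
  [/\ smooth (drift S), smooth (input_field S) & smooth (output S)].

Definition input_col (i : 'I_q) (x : 'cV[R]_n) : 'cV[R]_n :=
  col i (input_field S x).

Definition lie_output (j : 'I_q) (k : nat) : 'cV[R]_n -> R^o :=
  iter k (lie (drift S)) (fun x => output S x j 0).

(** [y^(gamma) = io_drift gamma x + io_decoupling gamma x *m u]. *)
Definition io_drift (gamma : 'I_q -> nat) (x : 'cV[R]_n) : 'cV[R]_q :=
  \col_j lie_output j (gamma j) x.

Definition io_decoupling (gamma : 'I_q -> nat) (x : 'cV[R]_n) : 'M[R]_q :=
  \matrix_(j, i) lie (input_col i) (lie_output j (gamma j).-1) x.

(** The last clause is "bounded away from singularity". That some input appears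
    in the [gamma j]-th derivative of the [j]-th output follows from the
    decoupling matrix being invertible on [D]. *)
Definition has_relative_degree (D : set 'cV[R]_n) (gamma : 'I_q -> nat) :
    Prop :=
  [/\ forall j, (0 < gamma j)%N,
      forall i j k, (k.+1 < gamma j)%N ->
        forall x, D x -> lie (input_col i) (lie_output j k) x = 0,
      forall x, D x -> io_decoupling gamma x \in unitmx
    & exists2 c : R, 0 < c &
        forall x, D x -> c <= `|\det (io_decoupling gamma x)|].

End relative_degree.

(** [None] stands for the absence of a nominal model. *)

Definition model_beta {R : realType} {n q} (gamma : 'I_q -> nat)
    (model : option (control_system R n q)) (x : 'cV[R]_n) : 'cV[R]_q :=
  if model is Some m
  then - invmx (io_decoupling m gamma x) *m io_drift m gamma x else 0.

Definition model_alpha {R : realType} {n q} (gamma : 'I_q -> nat)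
    (model : option (control_system R n q)) (x : 'cV[R]_n) : 'M[R]_q :=
  if model is Some m then invmx (io_decoupling m gamma x) else 0.

Section learned_controller.
Context {R : realType} {n q K1 K2 : nat}.

Notation param := ('cV[R]_K1 * 'cV[R]_K2)%type.

Variables (gamma : 'I_q -> nat) (plant : control_system R n q).
Variable model : option (control_system R n q).
Variables (beta : 'I_K1 -> 'cV[R]_n -> 'cV[R]_q).
Variables (alpha : 'I_K2 -> 'cV[R]_n -> 'M[R]_q).

Definition learned_beta (theta1 : 'cV[R]_K1) (x : 'cV[R]_n) : 'cV[R]_q :=
  \sum_k theta1 k 0 *: beta k x.

Definition learned_alpha (theta2 : 'cV[R]_K2) (x : 'cV[R]_n) : 'M[R]_q :=
  \sum_k theta2 k 0 *: alpha k x.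

Definition controller (theta : param) (x : 'cV[R]_n) (v : 'cV[R]_q) :
    'cV[R]_q :=
  (model_beta gamma model x + learned_beta theta.1 x)
  + (model_alpha gamma model x + learned_alpha theta.2 x) *m v.

Definition response (theta : param) (x : 'cV[R]_n) (v : 'cV[R]_q) :
    'cV[R]_q :=
  io_drift plant gamma x + io_decoupling plant gamma x *m controller theta x v.

Definition loss (x : 'cV[R]_n) (v : 'cV[R]_q) (theta : param) : R :=
  enorm (v - response theta x v) ^+ 2.

(** [x] and [v] are independent, [v] being uniform on the unit ball. *)
Definition expected_loss (X : probability 'cV[R]_n R) (theta : param) :
    \bar R :=
  'E_(X \x uniform_ball q)%E[fun xv => loss xv.1 xv.2 theta].

End learned_controller.

Definition measure_support {R : realType} {n} (P : probability 'cV[R]_n R) :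
    set 'cV[R]_n :=
  [set x | forall U, open U -> U x -> (0 < P U)%E].

Definition lin_indep_on {R : realType} {n K} {W : lmodType R}
    (D : set 'cV[R]_n) (F : 'I_K -> 'cV[R]_n -> W) : Prop :=
  forall c : 'I_K -> R,
    (forall x, D x -> \sum_k c k *: F k x = 0) -> forall k, c k = 0.

Section optimization.
Context {R : realType} {E : lmodType R}.
Local Open Scope convex_scope.
Implicit Types (C : set (convex_lmodType E)) (f : E -> \bar R).

Definition strongly_convex_function (N : E -> R) (mu : R) C
    (f : convex_lmodType E -> R^o) : Prop :=
  forall t : {i01 R}, {in C &, forall x y : convex_lmodType E,
    f (x <| t |> y) <= (f x <| t |> f y)
      - mu / 2 * t%:num * (1 - t%:num) * N (x - y : E) ^+ 2}.

(** Convexity of the problem of minimizing [f] over [C]. The objective is an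
    extended real, so that its being a real-valued function on [C] is part of
    the claim. *)
Definition convex_problem C f : Prop :=
  [/\ convex_set C, forall x, C x -> f x \is a fin_num
    & convex_function C (fine \o f)].

Definition strongly_convex_problem (N : E -> R) C f : Prop :=
  [/\ convex_set C, forall x, C x -> f x \is a fin_num
    & exists2 mu : R, 0 < mu & strongly_convex_function N mu C (fine \o f)].

End optimization.

Definition param_norm {R : realType} {K1 K2} (theta : 'cV[R]_K1 * 'cV[R]_K2) :
    R :=
  Num.sqrt (enorm theta.1 ^+ 2 + enorm theta.2 ^+ 2).

(* Main.v *)
Require Import Defs.
From mathcomp Require Import all_boot all_order all_algebra.
From mathcomp Require Import ring lra.
From mathcomp Require Import all_classical all_reals all_analysis.
From mathcomp Require Import measurable_realfun.

Set Implicit Arguments.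
Unset Strict Implicit.
Unset Printing Implicit Defensive.

Import Order.TTheory GRing.Theory Num.Theory.
Import numFieldNormedType.Exports.

Local Open Scope classical_set_scope.
Local Open Scope ring_scope.

(** The problem is a linear least-squares problem in disguise.  With
    [c = (theta1, theta2)], the tracking error [v - W_theta (x, v)] equals
    [e0 (x, v) - \sum_k c_k phi_k (x, v)], where [e0] is the error of the
    nominal controller and the features [phi_k] are [A_p beta_i] and
    [A_p alpha_j v] ([loss_residual]).  For an affine family of vectors
    [r c = e0 - Phi c], the parallelogram identity gives, with [s' = 1 - s],
      [|r (s c + s' c')|^2 = s |r c|^2 + s' |r c'|^2 - s s' |Phi (c - c')|^2],
    and integrating it ([mean_square_residual_conv]) yields
      [L (s c + s' c') = s L c + s' L c' - s s' Q (c - c')],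
    where [Q d] is the mean of [|Phi d|^2].  Since [Q >= 0], [L] is convex;
    since the identity is exact, strong convexity amounts to a bound
    [m |d|^2 <= Q d] with [m > 0] ([curvature_coercive]).

    Finiteness of the integrals comes from boundedness almost everywhere.  The
    law of [(x, v)] is carried by [D] times the unit ball ([full_domain]); there
    [b_p] and [A_p], being continuous, are bounded, and so is the inverse of
    [A_m] because its determinant is bounded away from zero.

    [Q] is a quadratic form with a Gram matrix, so the bound follows from
    definiteness of [Q] ([posdef_coercive]).  If [Q d = 0], the continuous
    function [|Phi d|^2] has integral zero, hence vanishes at every [(x, v)] with
    [x] in the support [D] and [v] in the open unit ball
    ([integral0_continuous_eq0]).  Cancelling the invertible matrix [A_p x]
    leaves [beta_d1 x + alpha_d2 x v = 0]; taking [v = 0], and then [v] along the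
    coordinate axes, separates both terms, and linear independence of each
    family gives [d = 0] ([mean_square_regression_inj]). *)

(** * Smoothness of iterated Lie derivatives *)

Section smooth_closure.
Context {R : realType} {n : nat}.

Lemma smooth_continuous (W : normedModType R) (f : 'cV[R]_n -> W) :
  smooth f -> continuous f.
Proof. by move=> /(_ [::])[]. Qed.

Lemma smooth_derivable (W : normedModType R) (f : 'cV[R]_n -> W) x i :
  smooth f -> derivable f x (delta_mx i 0).
Proof. by move=> /(_ [::])[_]; exact. Qed.

Lemma smooth_partial (W : normedModType R) (f : 'cV[R]_n -> W) i :
  smooth f -> smooth (partial i f).
Proof.
by move=> sf s; have := sf (rcons s i); rewrite /= -cats1 foldr_cat.
Qed.

(** Smoothness quantifies over iterated partial derivatives, and the derivative
    of a product is a sum of products: it is easier to find a class of functions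
    stable under partial derivatives than to describe every iterate. *)
Lemma smooth_coind (W : normedModType R) (C : set ('cV[R]_n -> W)) :
  (forall f, C f -> [/\ continuous f,
     forall x i, derivable f x (delta_mx i 0) & forall i, C (partial i f)]) ->
  forall f, C f -> smooth f.
Proof.
move=> CP f Cf s.
have /CP[cg dg _] : C (foldr partial f s) by elim: s => //= i s /CP[].
by [].
Qed.

Lemma smooth_entry p r (F : 'cV[R]_n -> 'M[R]_(p, r)) i j :
  smooth F -> smooth (fun x => F x i j : R^o).
Proof.
move=> sF.
pose C := [set f : 'cV[R]_n -> R^o | exists2 G : 'cV[R]_n -> 'M[R]_(p, r),
  smooth G & f = fun x => G x i j].
apply: (@smooth_coind _ C); last by exists F.
move=> _ [G sG ->]; split.
- move=> x; apply: (@continuous_comp _ _ _ G (fun M => M i j)).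
    exact: smooth_continuous.
  exact: coord_continuous.
- move=> x k; have Gd : derivable G x (delta_mx k 0) by exact: smooth_derivable.
  exact: ((derivable_mxP G x (delta_mx k 0)).1 Gd i j).
- move=> k; exists (partial k G); first exact: smooth_partial.
  apply/funext => x; rewrite /partial derive_mx ?mxE//.
  exact: smooth_derivable.
Qed.

(** The algebra generated by the smooth functions is stable under partial
    derivatives by the Leibniz rule, so [smooth_coind] applies to it. *)
Inductive smooth_alg : set ('cV[R]_n -> R^o) :=
| smooth_alg0 : smooth_alg (cst 0)
| smooth_alg_smooth f : smooth f -> smooth_alg f
| smooth_algD f g : smooth_alg f -> smooth_alg g -> smooth_alg (f \+ g)
| smooth_algM (f g : 'cV[R]_n -> R) :
    smooth_alg f -> smooth_alg g -> smooth_alg (f \* g).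

Lemma smooth_alg_sub : smooth_alg `<=` smooth.
Proof.
apply: smooth_coind => f; elim=> {f}.
- split=> [x|x i|i]; first exact: cst_continuous.
    exact: derivable_cst.
  rewrite (_ : partial i _ = cst 0); first exact: smooth_alg0.
  by apply/funext => x; rewrite /partial derive_cst.
- move=> f sf; split=> [||i].
  + exact: smooth_continuous.
  + by move=> x i; exact: smooth_derivable.
  + exact/smooth_alg_smooth/smooth_partial.
- move=> f g Af [cf df pf] Ag [cg dg pg]; split=> [x|x i|i].
  + by apply: continuousD; [exact: cf|exact: cg].
  + exact: derivableD.
  + rewrite (_ : partial i _ = partial i f \+ partial i g).
      exact: smooth_algD.
    by apply/funext => x; exact: deriveD.
- move=> f g Af [cf df pf] Ag [cg dg pg]; split=> [x|x i|i].
  + by apply: continuousM; [exact: cf|exact: cg].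
  + exact: derivableM.
  + rewrite (_ : partial i _ =
       ((f : _ -> R) \* partial i (g : _ -> R^o)) \+
       ((g : _ -> R) \* partial i (f : _ -> R^o))).
      by apply: smooth_algD; apply: smooth_algM.
    by apply/funext => x; exact: deriveM.
Qed.

Lemma smooth_sum I (s : seq I) (f : I -> 'cV[R]_n -> R^o) :
  (forall i, smooth (f i)) -> smooth (fun x => \sum_(i <- s) f i x : R^o).
Proof.
move=> sf; apply: smooth_alg_sub; elim: s => [|i s IH].
  rewrite (_ : (fun _ => _) = cst 0); first exact: smooth_alg0.
  by apply/funext => x; rewrite big_nil.
rewrite (_ : (fun _ => _) = f i \+ (fun x => \sum_(i <- s) f i x)).
  by apply: smooth_algD => //; exact: smooth_alg_smooth.
by apply/funext => x; rewrite big_cons.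
Qed.

Lemma smoothM (f g : 'cV[R]_n -> R^o) :
  smooth f -> smooth g -> smooth (fun x => f x * g x : R^o).
Proof.
move=> sf sg; apply: smooth_alg_sub.
by apply: (@smooth_algM f g); exact: smooth_alg_smooth.
Qed.

Lemma smooth_lie (F : 'cV[R]_n -> 'cV[R]_n) (h : 'cV[R]_n -> R^o) :
  (forall i, smooth (fun x => F x i 0 : R^o)) -> smooth h ->
  smooth (lie F h).
Proof.
move=> sF sh.
rewrite (_ : lie F h = fun x => \sum_i partial i h x * F x i 0).
  apply: (@smooth_sum _ _ (fun i x => partial i h x * F x i 0)) => i.
  apply: (@smoothM (partial i h) (fun x => F x i 0)); last exact: sF.
  exact: smooth_partial.
by apply/funext => x; rewrite /lie mxE; under eq_bigr do rewrite mxE.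
Qed.

Variables (q : nat) (S : control_system R n q).
Hypothesis sS : smooth_system S.

Lemma smooth_lie_output j k : smooth (lie_output S j k).
Proof.
have [sf _ sh] := sS; elim: k => [|k IH] /=; first exact: smooth_entry.
by apply: smooth_lie; [move=> i; exact: smooth_entry|exact: IH].
Qed.

Lemma continuous_io_drift gamma j :
  continuous (fun x => io_drift S gamma x j 0).
Proof.
under eq_fun do rewrite mxE.
exact/smooth_continuous/smooth_lie_output.
Qed.

Lemma continuous_io_decoupling gamma j i :
  continuous (fun x => io_decoupling S gamma x j i).
Proof.
under eq_fun do rewrite mxE.
have [_ sg _] := sS.
apply/(@smooth_continuous R^o)/smooth_lie; last exact: smooth_lie_output.
move=> k; rewrite (_ : (fun x => _) = fun x => input_field S x k i).
  exact: (@smooth_entry _ _ (input_field S)).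
by apply/funext => x; rewrite mxE.
Qed.

End smooth_closure.

(** * Measurable functions bounded on a set *)

Lemma measurable_inv (R : realType) :
  measurable_fun [set: R] (fun x : R => x^-1).
Proof.
have oP : open [set x : R | x != 0].
  exact: open_neq.
have -> : [set: R] = [set 0] `|` [set x : R | x != 0].
  by apply/seteqP; split=> // x _; have [->|x0] := eqVneq x 0; [left|right].
apply/measurable_funU => //; first exact: open_measurable.
split; first exact: measurable_fun_set1.
apply: open_continuous_measurable_fun => // x; rewrite inE /= => x0.
exact: inv_continuous.
Qed.

(** When [S] carries a probability measure, these functions are integrable; they
    form an algebra, so integrability of polynomial expressions in them comes
    for free.  Measurability is global since integrals range over the whole
    space. *)
Definition bounded_measurable d (T : measurableType d) (R : realType)
    (S : set T) (f : T -> R) :=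
  measurable_fun [set: T] f /\ exists M, forall t, S t -> `|f t| <= M.

Section bounded_measurable.
Context d (T : measurableType d) (R : realType) (S : set T).
Implicit Types f g : T -> R.
Local Notation bm := (bounded_measurable S).

Lemma bmeas_cst (c : R) : bm (fun=> c).
Proof. by split; [exact: measurable_cst|exists `|c|]. Qed.

Lemma bmeasD f g : bm f -> bm g -> bm (fun t => f t + g t).
Proof.
move=> [mf [M fM]] [mg [N gN]]; split; first exact: measurable_funD.
exists (M + N) => t St; rewrite (le_trans (ler_normD _ _))// lerD//.
  exact: fM.
exact: gN.
Qed.

Lemma bmeasM f g : bm f -> bm g -> bm (fun t => f t * g t).
Proof.
move=> [mf [M fM]] [mg [N gN]]; split; first exact: measurable_funM.
by exists (M * N) => t St; rewrite normrM ler_pM// ?fM ?gN.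
Qed.

Lemma bmeasN f : bm f -> bm (fun t => - f t).
Proof.
move=> bf; rewrite (_ : (fun t => _) = fun t => -1 * f t).
  exact: bmeasM (bmeas_cst _) bf.
by apply/funext => t; rewrite mulN1r.
Qed.

Lemma bmeas_sum I (s : seq I) (P : pred I) (f : I -> T -> R) :
  (forall i, bm (f i)) -> bm (fun t => \sum_(i <- s | P i) f i t).
Proof.
move=> bf; elim: s => [|i s IH].
  by under eq_fun do rewrite big_nil; exact: bmeas_cst.
under eq_fun do rewrite big_cons; case: (P i) => //.
exact: bmeasD.
Qed.

Lemma bmeas_prod I (s : seq I) (P : pred I) (f : I -> T -> R) :
  (forall i, bm (f i)) -> bm (fun t => \prod_(i <- s | P i) f i t).
Proof.
move=> bf; elim: s => [|i s IH].
  by under eq_fun do rewrite big_nil; exact: bmeas_cst.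
under eq_fun do rewrite big_cons; case: (P i) => //.
exact: bmeasM.
Qed.

Lemma bmeas_inv f (c : R) : 0 < c -> (forall t, S t -> c <= `|f t|) ->
  bm f -> bm (fun t => (f t)^-1).
Proof.
move=> c0 cf [mf _]; split.
  exact: (measurableT_comp (@measurable_inv R) mf).
exists c^-1 => t St; have cft := cf _ St.
by rewrite normfV lef_pV2 ?posrE// (lt_le_trans c0).
Qed.

Definition bmeas_mx m n (F : T -> 'M[R]_(m, n)) :=
  forall i j, bm (fun t => F t i j).

Lemma bmeas_mxD m n (F G : T -> 'M[R]_(m, n)) :
  bmeas_mx F -> bmeas_mx G -> bmeas_mx (fun t => F t + G t).
Proof.
by move=> bF bG i j; under eq_fun do rewrite mxE; exact: bmeasD.
Qed.

Lemma bmeas_mxN m n (F : T -> 'M[R]_(m, n)) :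
  bmeas_mx F -> bmeas_mx (fun t => - F t).
Proof. by move=> bF i j; under eq_fun do rewrite mxE; exact: bmeasN. Qed.

Lemma bmeas_mxM m n p (F : T -> 'M[R]_(m, n)) (G : T -> 'M[R]_(n, p)) :
  bmeas_mx F -> bmeas_mx G -> bmeas_mx (fun t => F t *m G t).
Proof.
move=> bF bG i j; under eq_fun do rewrite mxE.
by apply: bmeas_sum => k; exact: bmeasM.
Qed.

Lemma bmeas_mx_lin m n K (c : 'I_K -> R) (F : 'I_K -> T -> 'M[R]_(m, n)) :
  (forall k, bmeas_mx (F k)) -> bmeas_mx (fun t => \sum_k c k *: F k t).
Proof.
move=> bF i j; under eq_fun do rewrite summxE.
apply: bmeas_sum => k; under eq_fun do rewrite mxE.
exact: bmeasM (bmeas_cst _) (bF k i j).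
Qed.

Lemma bmeas_det n (F : T -> 'M[R]_n) :
  bmeas_mx F -> bm (fun t => \det (F t)).
Proof.
move=> bF; apply: bmeas_sum => s; apply: bmeasM; first exact: bmeas_cst.
exact: bmeas_prod.
Qed.

(** Cramer's rule: the lower bound on the determinant makes the inverse bounded
    on [S].  Outside of [S] the matrix may be singular, where [invmx] is the
    identity function. *)
Lemma bmeas_invmx n (F : T -> 'M[R]_n) (c : R) :
  0 < c -> (forall t, S t -> c <= `|\det (F t)|) ->
  bmeas_mx F -> bmeas_mx (fun t => invmx (F t)).
Proof.
move=> c0 cF bF i j.
have bdet := bmeas_det bF.
have badj : bm (fun t => (\det (F t))^-1 * \adj (F t) i j).
  apply: bmeasM; first exact: bmeas_inv cF bdet.
  under eq_fun do rewrite mxE; apply: bmeasM; first exact: bmeas_cst.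
  apply: bmeas_det => k l; under eq_fun do rewrite !mxE.
  exact: bF.
have -> : (fun t => invmx (F t) i j) = fun t =>
    if \det (F t) != 0 then (\det (F t))^-1 * \adj (F t) i j else F t i j.
  apply/funext => t; rewrite /invmx unitmxE unitfE.
  by case: ifP => // _; rewrite mxE.
split.
  apply: measurable_fun_ifT; [|exact: badj.1|exact: (bF i j).1].
  by apply: measurable_neg; apply: measurable_fun_eqr; [exact: bdet.1|].
have [M adjM] := badj.2; exists M => t St.
have det0 : \det (F t) != 0 by rewrite -normr_gt0 (lt_le_trans c0)// cF.
by rewrite det0; exact: adjM.
Qed.

End bounded_measurable.

Lemma bmeas_comp d1 d2 (T1 : measurableType d1) (T2 : measurableType d2)
    (R : realType) (S1 : set T1) (S2 : set T2) (h : T1 -> T2) (f : T2 -> R) :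
  measurable_fun [set: T1] h -> (forall t, S1 t -> S2 (h t)) ->
  bounded_measurable S2 f -> bounded_measurable S1 (fun t => f (h t)).
Proof.
move=> mh hS [mf [M fM]]; split; first exact: measurableT_comp mf mh.
by exists M => t /hS; exact: fM.
Qed.

Lemma bmeas_continuous (R : realType) m n (D : set 'M[R]_(m, n))
    (f : 'M[R]_(m, n) -> R) :
  compact D -> continuous f -> bounded_measurable D f.
Proof.
move=> cD cf; split; first exact: mx_continuous_measurable.
have cfD : compact (f @` D).
  by apply: continuous_compact => //; exact: continuous_subspaceT.
have [M [_ MP]] := compact_bounded cfD.
exists (M + 1) => x Dx; apply: MP; first by rewrite ltrDl.
by exists x.
Qed.

Lemma bmeas_integrable d (T : measurableType d) (R : realType)
    (P : probability T R) (S : set T) (f : T -> R) :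
  measurable S -> P (~` S) = 0%E -> bounded_measurable S f ->
  P.-integrable [set: T] (EFin \o f).
Proof.
move=> mS PS [mf [M fM]].
apply/(negligible_integrable (measurableC mS)) => //.
  exact/measurable_EFinP.
rewrite setTD setCK; apply: measurable_bounded_integrable => //.
- by rewrite (le_lt_trans (probability_le1 _ mS))// ltry.
- exact: measurable_funS mf.
- exists M; split; first exact: num_real.
  by move=> N MN t St; rewrite /= (le_trans (fM t St))// ltW.
Qed.

(** * Support of a probability measure and the uniform law on the ball *)

(** Balls with rational center and radius form a countable base, which is what
    makes the complement of the support a countable union of null sets. *)
Lemma rat_ball_basis (R : realType) n (U : set 'cV[R]_n) (x : 'cV[R]_n) :
  open U -> U x -> exists p : 'cV[rat]_n * rat,
    [/\ 0 < p.2, ball (map_mx ratr p.1 : 'cV[R]_n) (ratr p.2) x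
      & ball (map_mx ratr p.1 : 'cV[R]_n) (ratr p.2) `<=` U].
Proof.
move=> oU Ux.
have /nbhs_ballP[e /= e0 eU] := open_nbhs_nbhs (conj oU Ux).
have /rat_in_itvoo[r] : 0 < e / 2 by rewrite divr_gt0.
rewrite in_itv/= => /andP[r0 re].
have /choice[c cP] : forall i, exists c : rat, `|ratr c - x i 0| < ratr r.
  move=> i; have /rat_in_itvoo[c] : x i 0 - ratr r < x i 0 + ratr r.
    by rewrite ltrD2l gtrN.
  by rewrite in_itv/= -ltr_distl => ?; exists c.
have cx : ball (map_mx ratr (\col_i c i) : 'cV[R]_n) (ratr r) x.
  by split=> // i j; rewrite ord1 !mxE; exact: cP.
exists (\col_i c i, r); split=> //=; first by rewrite -(ltr0q R).
move=> v cv; apply: eU; apply: (@le_ball _ _ x (ratr r + ratr r)).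
  by rewrite [leRHS]splitr lerD// ltW.
exact: ball_triangle (ball_sym cx) cv.
Qed.

Lemma negligible_setC_support (R : realType) n (P : probability 'cV[R]_n R) :
  P.-negligible (~` measure_support P).
Proof.
pose B (p : 'cV[rat]_n * rat) := ball (map_mx ratr p.1 : 'cV[R]_n) (ratr p.2).
pose F k := if (unpickle k : option ('cV[rat]_n * rat)) is Some p
  then if (0 < p.2) && (P (B p) == 0)%E then B p else set0 else set0.
apply: (@negligibleS _ _ _ _ (\bigcup_k F k)); last first.
  apply: negligible_bigcup => k; rewrite /F.
  case: unpickle => [p|]; last exact: negligible_set0.
  case: ifPn => [/andP[p0 /eqP PB]|_]; last exact: negligible_set0.
  apply/negligibleP => //.
  by apply: mx_open_measurable; apply: ball_open.
move=> x /existsNP[U /not_implyP[oU /not_implyP[Ux /negP]]].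
rewrite -leNgt => PU0.
have [p [p0 px pU]] := rat_ball_basis oU Ux.
have oB : open (B p) by apply: ball_open; rewrite ltr0q.
exists (pickle p) => //; rewrite /F pickleK p0/=.
suff -> : P (B p) == 0%E by [].
rewrite -measure_le0 (le_trans _ PU0)// le_measure ?inE//.
  exact: mx_open_measurable.
exact: mx_open_measurable.
Qed.

Lemma continuous_sum (R : realType) (T : topologicalType) I (s : seq I)
    (f : I -> T -> R) :
  (forall i, continuous (f i)) -> continuous (fun t => \sum_(i <- s) f i t).
Proof.
move=> cf t; apply: cvg_big => [|i _]; last exact: cf.
exact: add_continuous.
Qed.

Lemma enorm_sqr (R : realType) n (v : 'cV[R]_n) :
  enorm v ^+ 2 = \sum_i v i 0 ^+ 2.
Proof. by rewrite sqr_sqrtr// sumr_ge0// => i _; exact: sqr_ge0. Qed.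

Lemma sum_sqr_continuous (R : realType) n :
  continuous (fun v : 'cV[R]_n => \sum_i v i 0 ^+ 2).
Proof.
apply: continuous_sum => i v.
by apply: continuousM; exact: coord_continuous.
Qed.

Lemma uniform_ballE (R : realType) q (V : set 'cV[R]_q) :
  uniform_ball q V = (lebesgue_cV q (V `&` eunit_ball q) *
    (fine (lebesgue_cV q (@eunit_ball R q)))^-1%:E)%E.
Proof.
have /andP[B0 Boo] := @lebesgue_eunit_ball R q.
rewrite /uniform_ball /mnormalize/= /mrestr setTI.
by rewrite gt_eqF//= lt_eqF.
Qed.

Lemma uniform_ballC (R : realType) q :
  uniform_ball q (~` @eunit_ball R q) = 0%E.
Proof. by rewrite uniform_ballE setICl measure0 mul0e. Qed.

(** A neighborhood of an interior point of the unit ball contains a cube lying in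
    the ball, whose Lebesgue measure is known. *)
Lemma uniform_ball_open (R : realType) q (V : set 'cV[R]_q) (v : 'cV[R]_q) :
  open V -> V v -> enorm v < 1 -> (0 < uniform_ball q V)%E.
Proof.
move=> oV Vv v1.
have /andP[B0 Boo] := @lebesgue_eunit_ball R q.
pose W := V `&` [set w | \sum_i w i 0 ^+ 2 < 1].
have oW : open W.
  apply: openI => //; have /continuousP := @sum_sqr_continuous R q.
  by move=> /(_ [set y | y < 1]); apply; exact: open_lt.
have Wv : W v by split=> //=; rewrite -enorm_sqr expr_lt1// sqrtr_ge0.
have /nbhs_ballP[e /= e0 eW] := open_nbhs_nbhs (conj oW Wv).
have e20 : 0 < e / 2 by rewrite divr_gt0.
pose B := [set w : 'cV[R]_q | forall i,
  (v - const_mx (e / 2)) i 0 <= w i 0 <= (v + const_mx (e / 2)) i 0].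
have LB : lebesgue_cV q B = (e ^+ q)%:E.
  rewrite lebesgue_cV_box => [|i]; last by rewrite !mxE lerD2l ge0_cp// ltW.
  under eq_bigr do rewrite !mxE opprD opprK addrACA subrr add0r -splitr.
  by rewrite prodr_const card_ord.
have BW : B `<=` W.
  move=> w wB; apply: eW; split=> // i j; rewrite ord1.
  have := wB i; rewrite !mxE => /andP[h1 h2].
  by rewrite /ball/= ltr_distl; apply/andP; split; lra.
rewrite uniform_ballE mule_gt0//; last first.
  by rewrite lte_fin invr_gt0 fine_gt0// B0.
have mB : measurable B.
  have -> : B = \bigcap_(i in [set: 'I_q]) ((fun w : 'cV[R]_q => w i 0) @^-1`
      `[(v - const_mx (e / 2)) i 0, (v + const_mx (e / 2)) i 0]).
    apply/seteqP; split => w wB i.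
      by move=> _; rewrite /= in_itv; exact: wB.
    by have := wB i Logic.I; rewrite /= in_itv.
  apply: fin_bigcap_measurable => // i _; rewrite -[X in measurable X]setTI.
  by apply: mx_coord_measurable => //; exact: measurable_itv.
apply: (@lt_le_trans _ _ (lebesgue_cV q B)).
  by rewrite LB lte_fin exprn_gt0.
apply: le_measure; rewrite ?inE//.
  apply: measurableI; first exact: mx_open_measurable.
  exact: measurable_eunit_ball.
move=> w /BW[Vw /= w1]; split=> //.
by rewrite /eunit_ball/= -(@expr_le1 _ 2)// ?sqrtr_ge0// enorm_sqr ltW.
Qed.

(** If [f] were positive at [(x, v)], it would be positive on a product of open
    sets, each of positive measure. *)
Lemma integral0_continuous_eq0 (R : realType) n q (P : probability 'cV[R]_n R)
    (f : 'cV[R]_n * 'cV[R]_q -> R) x v :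
  measurable_fun [set: 'cV[R]_n * 'cV[R]_q] f ->
  continuous f -> (forall t, 0 <= f t) ->
  (\int[P \x uniform_ball q]_t (f t)%:E = 0)%E ->
  measure_support P x -> enorm v < 1 -> f (x, v) = 0.
Proof.
move=> mf cf f0 If Px v1; apply/eqP/negPn/negP => fxv.
have fxv0 : 0 < f (x, v) by rewrite lt_neqAle eq_sym fxv f0.
have := cvgr_gt (f (x, v)) (cf (x, v)) 0 fxv0.
case=> -[A B] [/= nA nB] AB.
have PA : (0 < P A^°)%E.
  by apply: Px; [exact: open_interior|exact: nA].
have UB : (0 < uniform_ball q B^°)%E.
  by apply: uniform_ball_open v1; [exact: open_interior|exact: nB].
have mA : measurable A^° by apply: mx_open_measurable; exact: open_interior.
have mB : measurable B^° by apply: mx_open_measurable; exact: open_interior.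
have /ae_eq_integral_abs : (\int[P \x uniform_ball q]_t `|(f t)%:E| = 0)%E.
  by rewrite -If; apply: eq_integral => t _; rewrite gee0_abs// lee_fin.
case=> //; first exact/measurable_EFinP.
move=> N [mN N0 fN].
have ABN : A^° `*` B^° `<=` N.
  move=> t [/= At Bt]; apply: fN => /= /(_ Logic.I) [ft].
  have : 0 < f t.
    by rewrite [t]surjective_pairing; apply: AB; split; exact: interior_subset.
  by rewrite ft ltxx.
have : ((P \x uniform_ball q) (A^° `*` B^°) <= 0)%E.
  rewrite -N0 le_measure ?inE//; exact: measurableX.
by rewrite product_measure1E// leNgt mule_gt0.
Qed.

(** * Coercivity of definite quadratic forms *)

Section posdef_coercive.
Context {R : realFieldType} {K : nat} (G : 'M[R]_K).
Let b (c w : 'cV[R]_K) : R := (c^T *m G *m w) 0 0.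
Hypothesis Gsym : G^T = G.
Hypothesis G_ge0 : forall c, 0 <= b c c.
Hypothesis G_eq0 : forall c, b c c = 0 -> c = 0.

Let bC c w : b c w = b w c.
Proof.
have bT : c^T *m G *m w = (w^T *m G *m c)^T.
  by rewrite !trmx_mul trmxK Gsym mulmxA.
by rewrite /b bT mxE.
Qed.

(* Nonnegativity of the form at [b w w *: c - b c w *: w]. *)
Let cauchy_schwarz c w : b c w ^+ 2 <= b c c * b w w.
Proof.
have [/G_eq0 ->|w0] := eqVneq (b w w) 0.
  by rewrite /b !mulmx0 !mxE expr0n mulr0.
have w_gt0 : 0 < b w w by rewrite lt_neqAle eq_sym w0 G_ge0.
rewrite -subr_ge0 -(pmulr_rge0 _ w_gt0).
have := G_ge0 (b w w *: c - b c w *: w).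
suff -> : b (b w w *: c - b c w *: w) (b w w *: c - b c w *: w) =
    b w w * (b c c * b w w - b c w ^+ 2) by [].
have bB x y z : b x (y - z) = b x y - b x z.
  by rewrite /b mulmxBr !mxE.
have bZ x y k : b x (k *: y) = k * b x y.
  by rewrite /b -scalemxAr !mxE.
rewrite !(bB, bZ) !(bC (_ - _)) !(bB, bZ) (bC w c); ring.
Qed.

(** With [w_k] the inverse of [G] applied to the [k]-th basis vector, the
    coordinate [c_k] is [b c w_k], so the Cauchy-Schwarz inequality gives
    [c_k ^ 2 <= b c c * b w_k w_k]; summing over [k] bounds [|c|^2]. *)
Lemma posdef_coercive :
  exists2 m : R, 0 < m & forall c : 'cV[R]_K, m * \sum_k c k 0 ^+ 2 <= b c c.
Proof.
have Gu : G \in unitmx.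
  rewrite unitmxE unitfE; apply/negP => /det0P[v v0 vG].
  have : v^T = 0 by apply: G_eq0; rewrite /b trmxK vG mul0mx mxE.
  by move/eqP; rewrite trmx_eq0 (negbTE v0).
pose w k := invmx G *m delta_mx k 0 : 'cV[R]_K.
have bw k c : b c (w k) = c k 0.
  rewrite /b /w -mulmxA (mulKVmx Gu) mxE (bigD1 k)//= !mxE !eqxx mulr1.
  by rewrite big1 ?addr0// => i ik; rewrite !mxE (negbTE ik) mulr0.
have s0 : 0 < 1 + \sum_k b (w k) (w k).
  by rewrite ltr_pwDl// sumr_ge0.
(* Adding 1 keeps the constant invertible when [K = 0]. *)
exists (1 + \sum_k b (w k) (w k))^-1; first by rewrite invr_gt0.
move=> c; rewrite ler_pdivrMl// mulrDl mul1r -[leLHS]add0r lerD//.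
rewrite mulr_suml ler_sum// => k _.
by rewrite -bw mulrC cauchy_schwarz.
Qed.

End posdef_coercive.

(** * Linear least squares in mean square *)

Section least_squares.
Context d (T : measurableType d) (R : realType) (P : probability T R).
Variables (S : set T) (mS : measurable S) (PS : P (~` S) = 0%E).
Variables (q K : nat) (e0 : T -> 'cV[R]_q) (phi : 'I_K -> T -> 'cV[R]_q).
Hypothesis be0 : bmeas_mx S e0.
Hypothesis bphi : forall k, bmeas_mx S (phi k).
Local Notation "'\E' f" := (Rintegral P [set: T] f) (at level 10, f at level 8).

Let integrable_bm (f : T -> R) :
  bounded_measurable S f -> P.-integrable [set: T] (EFin \o f).
Proof. exact: bmeas_integrable. Qed.

Lemma Rintegral_sum I (s : seq I) (f : I -> T -> R) :
  (forall i, bounded_measurable S (f i)) ->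
  \E (fun t => \sum_(i <- s) f i t) = \sum_(i <- s) \E (f i).
Proof.
move=> bf; elim: s => [|i s IH].
  under eq_Rintegral do rewrite big_nil.
  by rewrite Rintegral_cst// mul0r big_nil.
under eq_Rintegral do rewrite big_cons.
rewrite RintegralD//; first by rewrite IH big_cons.
  exact: integrable_bm.
exact/integrable_bm/bmeas_sum.
Qed.

Definition regression (c : 'cV[R]_K) (t : T) : 'cV[R]_q :=
  \sum_k c k 0 *: phi k t.

Definition residual c t := e0 t - regression c t.

Definition mean_square (F : T -> 'cV[R]_q) : R :=
  \E (fun t => enorm (F t) ^+ 2).

Lemma bmeas_regression c : bmeas_mx S (regression c).
Proof. exact: bmeas_mx_lin. Qed.

Lemma bmeas_residual c : bmeas_mx S (residual c).
Proof. exact/bmeas_mxD/bmeas_mxN/bmeas_regression. Qed.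

Lemma bmeas_enorm_sqr (F : T -> 'cV[R]_q) :
  bmeas_mx S F -> bounded_measurable S (fun t => enorm (F t) ^+ 2).
Proof.
move=> bF; under eq_fun do rewrite enorm_sqr.
by apply: bmeas_sum => i; exact: bmeasM.
Qed.

(** The integrated parallelogram identity: the defect of convexity is an exact
    quadratic term, which decides both convexity and strong convexity. *)
Lemma mean_square_residual_conv (s : R) c c' :
  mean_square (residual (s *: c + (1 - s) *: c')) =
  s * mean_square (residual c) + (1 - s) * mean_square (residual c')
  - s * (1 - s) * mean_square (regression (c - c')).
Proof.
have regD a b x y t : regression (a *: x + b *: y) t =
    a *: regression x t + b *: regression y t.
  rewrite /regression !scaler_sumr -big_split/=; apply: eq_bigr => k _.
  by rewrite !mxE scalerDl !scalerA.
have pt t : enorm (residual (s *: c + (1 - s) *: c') t) ^+ 2 =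
    s * enorm (residual c t) ^+ 2 + (1 - s) * enorm (residual c' t) ^+ 2
    - s * (1 - s) * enorm (regression (c - c') t) ^+ 2.
  rewrite -[c in c - c']scale1r -[- c']scaleN1r /residual !regD !enorm_sqr.
  rewrite !mulr_sumr -big_split -sumrB/=; apply: eq_bigr => i _.
  by rewrite !mxE; ring.
rewrite /mean_square; under eq_Rintegral do rewrite pt.
have br x := integrable_bm (bmeas_enorm_sqr (bmeas_residual x)).
have bg x := integrable_bm (bmeas_enorm_sqr (bmeas_regression x)).
have bZ k f : P.-integrable [set: T] (EFin \o f) ->
  P.-integrable [set: T] (EFin \o (fun t => k * f t)).
  by move=> fi; have := integrableZl measurableT k fi.
rewrite RintegralB//; last 2 first.
- by have := integrableD measurableT (bZ s _ (br c)) (bZ (1 - s) _ (br c')).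
- exact: bZ _ _ (bg _).
rewrite RintegralD//; last 2 first.
- exact: bZ _ _ (br c).
- exact: bZ _ _ (br c').
by rewrite !RintegralZl.
Qed.

Definition gram : 'M[R]_K :=
  \matrix_(k, l) \E (fun t => \sum_i phi k t i 0 * phi l t i 0).

Lemma mean_square_regression c :
  mean_square (regression c) = (c^T *m gram *m c) 0 0.
Proof.
have bkl k l :
    bounded_measurable S (fun t => \sum_i phi k t i 0 * phi l t i 0).
  by apply: bmeas_sum => i; apply: bmeasM; exact: bphi.
have bc (k : R) f :
    bounded_measurable S f -> bounded_measurable S (fun t => k * f t).
  by move=> bf; exact: bmeasM (bmeas_cst _ _) bf.
have pt t : enorm (regression c t) ^+ 2 =
    \sum_l \sum_k c k 0 * c l 0 * (\sum_i phi k t i 0 * phi l t i 0).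
  rewrite enorm_sqr.
  under eq_bigr => i _.
    rewrite summxE expr2 big_distrlr/=.
    over.
  rewrite exchange_big/= [RHS]exchange_big/=; apply: eq_bigr => k _.
  rewrite exchange_big/=; apply: eq_bigr => l _.
  rewrite mulr_sumr; apply: eq_bigr => i _.
  by rewrite !mxE; ring.
rewrite /mean_square; under eq_Rintegral do rewrite pt.
rewrite Rintegral_sum; last by move=> l; apply: bmeas_sum => k; exact: bc.
rewrite mxE; apply: eq_bigr => l _.
rewrite Rintegral_sum; last by move=> k; exact: bc.
rewrite mxE mulr_suml; apply: eq_bigr => k _.
rewrite RintegralZl//; last exact: integrable_bm.
by rewrite !mxE; ring.
Qed.

Lemma mean_square_ge0 F : 0 <= mean_square F.
Proof. by apply: Rintegral_ge0 => t _; exact: sqr_ge0. Qed.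

Lemma mean_square_regression_coercive :
  (forall c, mean_square (regression c) = 0 -> c = 0) ->
  exists2 m : R, 0 < m & forall c : 'cV[R]_K,
    m * \sum_k c k 0 ^+ 2 <= mean_square (regression c).
Proof.
move=> inj.
have [||c|m m0 mP] := @posdef_coercive _ _ gram.
- by apply/matrixP => k l; rewrite !mxE; apply: eq_Rintegral => t _;
    apply: eq_bigr => i _; rewrite mulrC.
- by move=> c; rewrite -mean_square_regression mean_square_ge0.
- by rewrite -mean_square_regression; exact: inj.
by exists m => // c; rewrite mean_square_regression.
Qed.

End least_squares.

(** * Entrywise continuity of matrix-valued functions *)

Definition continuous_mx (R : realType) (T : topologicalType) m n
    (F : T -> 'M[R]_(m, n)) :=
  forall i j, continuous (fun t => F t i j).

Lemma continuous_mxM (R : realType) (T : topologicalType) m n p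
    (F : T -> 'M[R]_(m, n)) (G : T -> 'M[R]_(n, p)) :
  continuous_mx F -> continuous_mx G -> continuous_mx (fun t => F t *m G t).
Proof.
move=> cF cG i j; under eq_fun do rewrite mxE.
by apply: continuous_sum => k t; apply: continuousM; [exact: cF|exact: cG].
Qed.

Lemma continuous_mx_comp (R : realType) (T U : topologicalType) m n
    (h : T -> U) (F : U -> 'M[R]_(m, n)) :
  continuous h -> continuous_mx F -> continuous_mx (fun t => F (h t)).
Proof.
move=> ch cF i j t.
by apply: (@continuous_comp _ _ _ h (fun u => F u i j)); [exact: ch|exact: cF].
Qed.

Lemma continuousW_mx (R : realType) (T : topologicalType) m n
    (F : T -> 'M[R]_(m, n)) : continuous F -> continuous_mx F.
Proof.
move=> cF i j t; apply: (@continuous_comp _ _ _ F (fun M => M i j)).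
  exact: cF.
exact: coord_continuous.
Qed.

(** * The learning problem as a least-squares problem *)

Section learning_problem.
Context {R : realType} {n q K1 K2 : nat}.
Variables (D : set 'cV[R]_n) (compactD : compact D) (gamma : 'I_q -> nat).
Variables (plant : control_system R n q) (smooth_plant : smooth_system plant).
Hypothesis degree_plant : has_relative_degree plant D gamma.
Variable model : option (control_system R n q).
Hypothesis smooth_model : forall m, model = Some m -> smooth_system m.
Hypothesis degree_model :
  forall m, model = Some m -> has_relative_degree m D gamma.
Variables (beta : 'I_K1 -> 'cV[R]_n -> 'cV[R]_q).
Variables (alpha : 'I_K2 -> 'cV[R]_n -> 'M[R]_q).
Hypothesis continuous_beta : forall k, continuous (beta k).
Hypothesis continuous_alpha : forall k, continuous (alpha k).
Variables (X : probability 'cV[R]_n R) (support_X : measure_support X = D).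

Let A x := io_decoupling plant gamma x.
Let S : set ('cV[R]_n * 'cV[R]_q) := D `*` eunit_ball q.
Let P : probability ('cV[R]_n * 'cV[R]_q)%type R :=
  (X \x @uniform_ball R q)%E.

(** The contribution of each scalar parameter to the response: the parameters of
    [beta] come first, as in [col_mx theta.1 theta.2]. *)
Definition feature (k : 'I_(K1 + K2)) (t : 'cV[R]_n * 'cV[R]_q) : 'cV[R]_q :=
  A t.1 *m match fintype.split k with
           | inl i => beta i t.1
           | inr j => alpha j t.1 *m t.2
           end.

(** The tracking error at [theta = 0]. *)
Definition nominal_residual (t : 'cV[R]_n * 'cV[R]_q) : 'cV[R]_q :=
  t.2 - (io_drift plant gamma t.1
         + A t.1 *m (model_beta gamma model t.1
                     + model_alpha gamma model t.1 *m t.2)).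

Lemma regression_feature c1 c2 t :
  regression feature (col_mx c1 c2) t =
  A t.1 *m (learned_beta beta c1 t.1 + learned_alpha alpha c2 t.1 *m t.2).
Proof.
rewrite /regression big_split_ord mulmxDr; congr (_ + _).
  rewrite mulmx_sumr; apply: eq_bigr => k _.
  by rewrite col_mxEu /feature (unsplitK (inl k)) scalemxAr.
rewrite mulmx_suml mulmx_sumr; apply: eq_bigr => k _.
by rewrite col_mxEd /feature (unsplitK (inr k)) -scalemxAl scalemxAr.
Qed.

Lemma loss_residual theta t :
  loss gamma plant model beta alpha t.1 t.2 theta =
  enorm (residual nominal_residual feature (col_mx theta.1 theta.2) t) ^+ 2.
Proof.
congr (enorm _ ^+ 2); rewrite /residual regression_feature /nominal_residual.
rewrite /response /controller -/(A _) !mulmxDl !mulmxDr.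
rewrite -!addrA; congr (_ + _); rewrite -!opprD; congr (- _).
rewrite -!addrA; congr (_ + (_ + _)).
by rewrite addrCA.
Qed.

Let bmeas_fst p r (F : 'cV[R]_n -> 'M[R]_(p, r)) :
  bmeas_mx D F -> bmeas_mx S (fun t => F t.1).
Proof.
move=> bF i j.
by apply: (bmeas_comp (h := fst) measurable_fst _ (bF i j)) => t [].
Qed.

Let bmeas_continuous_mx p r (F : 'cV[R]_n -> 'M[R]_(p, r)) :
  continuous_mx F -> bmeas_mx D F.
Proof. by move=> cF i j; exact: bmeas_continuous. Qed.

Let bmeas_snd : bmeas_mx S (fun t => t.2).
Proof.
move=> i j; rewrite ord1; split.
  exact: (measurableT_comp (mx_coord_measurable i 0)).
exists 1 => t [_ /= t1]; rewrite -(@expr_le1 _ 2)// real_normK ?num_real//.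
apply: (@le_trans _ _ (enorm t.2 ^+ 2)); last by rewrite expr_le1// sqrtr_ge0.
by rewrite enorm_sqr (bigD1 i)//= lerDl sumr_ge0// => k _; exact: sqr_ge0.
Qed.

Let continuous_A : continuous_mx A.
Proof. by move=> i j; exact: continuous_io_decoupling. Qed.

Let continuous_drift (m : control_system R n q) :
  smooth_system m -> continuous_mx (io_drift m gamma).
Proof. by move=> sm i j; rewrite ord1; exact: continuous_io_drift. Qed.

(* Here the uniform lower bound on the determinant of the decoupling matrix of
   the model enters. *)
Let bmeas_model_alpha : bmeas_mx D (model_alpha gamma model).
Proof.
rewrite /model_alpha; case Em : model => [m|].
  have [_ _ _ [c c0 cdet]] := degree_model Em.
  apply: bmeas_invmx c0 cdet _; apply: bmeas_continuous_mx => i j.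
  exact/continuous_io_decoupling/smooth_model.
by move=> i j; under eq_fun do rewrite mxE; exact: bmeas_cst.
Qed.

Let bmeas_model_beta : bmeas_mx D (model_beta gamma model).
Proof.
have := bmeas_model_alpha; rewrite /model_alpha /model_beta.
case Em : model => [m|] bmi; last first.
  by move=> i j; under eq_fun do rewrite mxE; exact: bmeas_cst.
apply: bmeas_mxM; first exact: bmeas_mxN.
exact/bmeas_continuous_mx/continuous_drift/smooth_model.
Qed.

Lemma bmeas_feature k : bmeas_mx S (feature k).
Proof.
apply: bmeas_mxM; first exact/bmeas_fst/bmeas_continuous_mx.
case: fintype.split => i.
  exact/bmeas_fst/bmeas_continuous_mx/continuousW_mx.
apply: bmeas_mxM; last exact: bmeas_snd.
exact/bmeas_fst/bmeas_continuous_mx/continuousW_mx.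
Qed.

Lemma bmeas_nominal_residual : bmeas_mx S nominal_residual.
Proof.
apply: bmeas_mxD; first exact: bmeas_snd.
apply/bmeas_mxN/bmeas_mxD.
  exact/bmeas_fst/bmeas_continuous_mx/continuous_drift.
apply: bmeas_mxM; first exact/bmeas_fst/bmeas_continuous_mx.
apply: bmeas_mxD; first exact: bmeas_fst.
by apply: bmeas_mxM; [exact: bmeas_fst|exact: bmeas_snd].
Qed.

Let mD : measurable D.
Proof.
rewrite -(setCK D); apply: measurableC; apply: mx_open_measurable.
apply: closed_openC; apply: compact_closed; last exact: compactD.
exact: (@norm_hausdorff R 'cV[R]_n).
Qed.

Lemma measurable_domain : measurable S.
Proof. by apply: measurableX => //; exact: measurable_eunit_ball. Qed.

Lemma full_domain : P (~` S) = 0%E.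
Proof.
have full d (T : measurableType d) (Q : probability T R) (B : set T) :
    measurable B -> Q (~` B) = 0%E -> Q B = 1%E.
  move=> mB QB; rewrite -[B]setCK probability_setC ?QB ?sube0//.
  exact: measurableC.
have mB := @measurable_eunit_ball R q.
have XD : X D = 1%E.
  apply: full => //; apply: measure_negligible; first exact: measurableC.
  by rewrite -support_X; exact: negligible_setC_support.
have UB : uniform_ball q (@eunit_ball R q) = 1%E.
  by apply: (@full _ _ (@uniform_ball R q)) => //; exact: uniform_ballC.
rewrite probability_setC; last exact: measurable_domain.
have PS : P S = (X D * uniform_ball q (@eunit_ball R q))%E.
  exact: product_measure1E.
by rewrite PS XD UB mule1 subee.
Qed.

Lemma expected_loss_mean_square theta :
  fine (expected_loss gamma plant model beta alpha X theta) =
  mean_square P (residual nominal_residual feature (col_mx theta.1 theta.2)).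
Proof.
rewrite /expected_loss unlock; congr fine; apply: eq_integral => t _.
by rewrite loss_residual.
Qed.

Lemma expected_loss_fin_num theta :
  expected_loss gamma plant model beta alpha X theta \is a fin_num.
Proof.
rewrite /expected_loss unlock.
under eq_integral do rewrite loss_residual.
apply: integrable_fin_num => //.
apply: (bmeas_integrable measurable_domain full_domain).
apply/bmeas_enorm_sqr/bmeas_residual; last exact: bmeas_feature.
exact: bmeas_nominal_residual.
Qed.

(** A combination of features involves only the plant and the learned functions,
    so it is continuous everywhere and [integral0_continuous_eq0] applies. *)
Lemma regression_eq0 c :
  mean_square P (regression feature c) = 0 ->
  forall x v, D x -> enorm v < 1 -> regression feature c (x, v) = 0.
Proof.
move=> Q0 x v Dx v1.
have breg := bmeas_enorm_sqr (bmeas_regression bmeas_feature c).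
pose f t := enorm (regression feature c t) ^+ 2.
have fE : f (x, v) = 0.
  apply: (@integral0_continuous_eq0 _ _ _ X f); rewrite ?support_X//.
  - exact: breg.1.
  - rewrite /f; under eq_fun do rewrite enorm_sqr.
    have creg i : continuous (fun t => regression feature c t i 0).
      under eq_fun do rewrite summxE; apply: continuous_sum => k.
      under eq_fun do rewrite mxE.
      suff cf : continuous_mx (feature k).
        by move=> t; apply: continuousM; [exact: cst_continuous|exact: cf].
      have cfst : continuous (fst : 'cV[R]_n * 'cV[R]_q -> _).
        by move=> t; exact: cvg_fst.
      have csnd : continuous (snd : 'cV[R]_n * 'cV[R]_q -> _).
        by move=> t; exact: cvg_snd.
      apply: continuous_mxM; first exact: continuous_mx_comp.
      case: fintype.split => l; first exact/continuous_mx_comp/continuousW_mx.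
      apply: continuous_mxM; last exact: continuousW_mx.
      exact/continuous_mx_comp/continuousW_mx.
    by apply: continuous_sum => i t; apply: continuousM; exact: creg.
  - by move=> t; exact: sqr_ge0.
  - rewrite -[LHS]fineK; first by congr EFin.
    apply: integrable_fin_num => //.
    exact: (bmeas_integrable measurable_domain full_domain).
move: fE; rewrite /f enorm_sqr => /psumr_eq0P fi.
apply/colP => i; rewrite mxE; apply/eqP; rewrite -sqrf_eq0 fi// => j _.
exact: sqr_ge0.
Qed.

(** The two families are independent separately, not jointly: what decouples them
    is that [beta] enters without [v] and [alpha] linearly in [v], with [v]
    ranging over a neighborhood of 0. *)
Lemma mean_square_regression_inj :
  lin_indep_on D beta -> lin_indep_on D alpha ->
  forall c, mean_square P (regression feature c) = 0 -> c = 0.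
Proof.
move=> ibeta ialpha c /regression_eq0 c0.
rewrite -[c]vsubmxK in c0 *.
set c1 := usubmx c in c0 *; set c2 := dsubmx c in c0 *.
have bav x v : D x -> enorm v < 1 ->
    learned_beta beta c1 x + learned_alpha alpha c2 x *m v = 0.
  move=> Dx v1; have := c0 _ _ Dx v1; rewrite regression_feature/= => Abav.
  have [_ _ Au _] := degree_plant.
  by rewrite -[LHS](mulKmx (Au x Dx)) Abav mulmx0.
have b0 x : D x -> learned_beta beta c1 x = 0.
  move=> Dx; have := bav x 0 Dx; rewrite mulmx0 addr0; apply.
  by rewrite -(@expr_lt1 _ 2)// ?sqrtr_ge0// enorm_sqr big1// => i _;
    rewrite mxE expr0n.
have a0 x : D x -> learned_alpha alpha c2 x = 0.
  move=> Dx; apply/matrixP => i j.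
  (* Half a basis vector lies in the open unit ball. *)
  have := bav x (2^-1 *: delta_mx j 0) Dx.
  rewrite b0// add0r => /(_ _)/colP/(_ i); rewrite !mxE (bigD1 j)//= !mxE !eqxx.
  rewrite big1 => [|k kj]; last by rewrite !mxE (negbTE kj) !mulr0.
  rewrite addr0 mulr1 => aij; apply/eqP.
  suff /aij/eqP : enorm (2^-1 *: delta_mx j 0 : 'cV[R]_q) < 1.
    by rewrite mulf_eq0 invr_eq0 pnatr_eq0 orbF.
  rewrite -(@expr_lt1 _ 2)// ?sqrtr_ge0// enorm_sqr (bigD1 j)//= big1 => [|k kj].
    by rewrite !mxE !eqxx mulr1 addr0 expr2; lra.
  by rewrite !mxE (negbTE kj) mulr0 expr0n.
have c10 : c1 = 0 by apply/colP => k; rewrite (ibeta (fun k => c1 k 0) b0) mxE.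
have c20 : c2 = 0 by apply/colP => k; rewrite (ialpha (fun k => c2 k 0) a0) mxE.
by rewrite c10 c20 col_mx0.
Qed.

(** Half the second derivative of the expected loss in the direction [theta]. *)
Definition curvature (theta : 'cV[R]_K1 * 'cV[R]_K2) : R :=
  mean_square P (regression feature (col_mx theta.1 theta.2)).

Lemma expected_loss_conv (s : R) (x y : 'cV[R]_K1 * 'cV[R]_K2) :
  let L := expected_loss gamma plant model beta alpha X in
  fine (L (s *: x + (1 - s) *: y)) =
  s * fine (L x) + (1 - s) * fine (L y) - s * (1 - s) * curvature (x - y).
Proof.
(* Abstracting the loss keeps rewriting from comparing two of its values by
   unfolding the expectation. *)
move=> L; suff Lconv f : (forall theta, f theta = mean_square P
      (residual nominal_residual feature (col_mx theta.1 theta.2))) ->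
    f (s *: x + (1 - s) *: y) =
    s * f x + (1 - s) * f y - s * (1 - s) * curvature (x - y).
  exact: (Lconv (fine \o L) expected_loss_mean_square).
move=> fE; rewrite !fE /curvature/=.
have -> : col_mx (s *: x.1 + (1 - s) *: y.1) (s *: x.2 + (1 - s) *: y.2) =
    s *: col_mx x.1 x.2 + (1 - s) *: col_mx y.1 y.2.
  by rewrite !scale_col_mx add_col_mx.
have -> : col_mx (x.1 - y.1) (x.2 - y.2) = col_mx x.1 x.2 - col_mx y.1 y.2.
  by rewrite opp_col_mx add_col_mx.
apply: (mean_square_residual_conv measurable_domain full_domain).
  exact: bmeas_nominal_residual.
exact: bmeas_feature.
Qed.

Lemma curvature_coercive :
  lin_indep_on D beta -> lin_indep_on D alpha ->
  exists2 m : R, 0 < m &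
    forall theta, m * param_norm theta ^+ 2 <= curvature theta.
Proof.
move=> ibeta ialpha.
have [m m0 mP] := mean_square_regression_coercive measurable_domain full_domain
  bmeas_feature (@mean_square_regression_inj ibeta ialpha).
exists m => // theta; apply: le_trans (mP _).
rewrite sqr_sqrtr ?addr_ge0 ?sqr_ge0// !enorm_sqr big_split_ord/=.
under [X in _ <= m * (X + _)]eq_bigr do rewrite col_mxEu.
by under [X in _ <= m * (_ + X)]eq_bigr do rewrite col_mxEd.
Qed.

End learning_problem.

(** * Convexity and strong convexity *)

Lemma convex_setX (R : realType) (E F : lmodType R)
    (C1 : set (convex_lmodType E)) (C2 : set (convex_lmodType F)) :
  convex_set C1 -> convex_set C2 ->
  convex_set (C1 `*` C2 : set (convex_lmodType (E * F)%type)).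
Proof.
move=> cC1 cC2 x y t; rewrite !inE => -[x1 x2] [y1 y2]; split.
  by have := cC1 x.1 y.1 t; rewrite !inE; apply.
by have := cC2 x.2 y.2 t; rewrite !inE; apply.
Qed.

Theorem lemma2 (R : realType) (n q : nat)
  (D : set 'cV[R]_n) (compactD : compact D)
  (gamma : 'I_q -> nat)
  (plant : control_system R n q)
  (smooth_plant : smooth_system plant)
  (degree_plant : has_relative_degree plant D gamma)
  (model : option (control_system R n q))
  (smooth_model : forall m, model = Some m -> smooth_system m)
  (degree_model : forall m, model = Some m -> has_relative_degree m D gamma)
  (K1 K2 : nat)
  (Theta1 : set 'cV[R]_K1) (Theta2 : set 'cV[R]_K2)
  (convex_Theta1 : convex_set Theta1) (convex_Theta2 : convex_set Theta2)
  (beta : 'I_K1 -> 'cV[R]_n -> 'cV[R]_q)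
  (alpha : 'I_K2 -> 'cV[R]_n -> 'M[R]_q)
  (continuous_beta : forall k, continuous (beta k))
  (continuous_alpha : forall k, continuous (alpha k))
  (X : probability 'cV[R]_n R) (support_X : measure_support X = D) :
  let L := expected_loss gamma plant model beta alpha X in
  convex_problem (Theta1 `*` Theta2) L /\
  (lin_indep_on D beta -> lin_indep_on D alpha ->
   strongly_convex_problem param_norm (Theta1 `*` Theta2) L).
Proof.
move=> L.
have Lfin theta : L theta \is a fin_num.
  exact: (expected_loss_fin_num compactD).
have cTheta := convex_setX convex_Theta1 convex_Theta2.
pose Q := curvature gamma plant beta alpha X.
have LE (t : {i01 R}) (x y : convex_lmodType ('cV[R]_K1 * 'cV[R]_K2)%type) :
    (fine \o L) (conv t x y) = t%:num * fine (L x) + (1 - t%:num) * fine (L y)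
      - t%:num * (1 - t%:num) * Q (x - y).
  exact: (expected_loss_conv compactD).
have t01 (t : {i01 R}) : 0 <= t%:num * (1 - t%:num).
  by rewrite mulr_ge0// subr_ge0.
split.
  split=> // t x y _ _; rewrite LE gerBl mulr_ge0//.
  exact: mean_square_ge0.
move=> ibeta ialpha; split=> //.
have [m m0 mP] : exists2 m : R, 0 < m &
    forall theta, m * param_norm theta ^+ 2 <= Q theta.
  exact: (curvature_coercive compactD).
(* The modulus appears halved in the definition of strong convexity. *)
exists (2 * m) => [|t x y _ _]; first by rewrite mulr_gt0.
rewrite LE lerB//.
have -> : 2 * m / 2 * t%:num * (1 - t%:num) = t%:num * (1 - t%:num) * m.
  by field.
by rewrite -(mulrA (t%:num * (1 - t%:num))) ler_wpM2l.
Qed.
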